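(* Let $G$ be a complete $3$-partite graph with parts $V_1,V_2,V_3$, and assume $G\not\cong K_3$. Then $\chi^{ven}(G)=1$ if $|V_i|\neq |V_j|$ for all $1\le i<j\le 3$, and $\chi^{ven}(G)=2$ otherwise.
   Context: All graphs are simple and undirected. For a total weighting $w:V(G)\cup E(G)\to\{1,\dots,k\}$ and a vertex $v$, put $\sigma^{ven}(v)=w(v)+\sum_{e\ni v}w(e)+\sum_{u\in N(v)}w(u)$, where $N(v)$ is the open neighborhood of $v$. The weighting is a neighbor full sum distinguishing total $k$-coloring if $\sigma^{ven}(u)\ne\sigma^{ven}(v)$ for every edge $uv$. $\chi^{ven}(G)$ is the minimum $k$ for which such a weighting exists. A complete $3$-partite graph has vertex set partitioned into three nonempty parts, two vertices being adjacent iff they lie in different parts. *)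

(* Defs.v *)
From mathcomp Require Import all_boot.

Set Implicit Arguments.
Unset Strict Implicit.
Unset Printing Implicit Defensive.

Record sgraph := SGraph {
  vertex :> finType;
  adj : rel vertex;
  adj_sym : symmetric adj;
  adj_irrefl : irreflexive adj
}.

Lemma neq_sym (T : eqType) : symmetric (fun x y : T => x != y).
Proof. by move=> x y; rewrite eq_sym. Qed.

Lemma neq_irrefl (T : eqType) : irreflexive (fun x y : T => x != y).
Proof. by move=> x; rewrite eqxx. Qed.

Definition complete_graph (n : nat) : sgraph :=
  SGraph (@neq_sym 'I_n) (@neq_irrefl 'I_n).

Definition graph_iso (G H : sgraph) : Prop :=
  exists2 f : G -> H, bijective f & forall x y : G, adj (f x) (f y) = adj x y.

Definition edges (G : sgraph) : {set {set G}} :=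
  [set [set p.1; p.2] | p : G * G & adj p.1 p.2].

Definition edge (G : sgraph) : Type := {e : {set G} | e \in edges G}.

Definition complete_multipartite (G : sgraph) (r : nat) (V : 'I_r -> {set G})
    : Prop :=
  [/\ forall i, V i != set0,
      forall i j, i != j -> [disjoint V i & V j],
      \bigcup_i V i = [set: G]
    & forall x y : G,
        adj x y <-> exists i j, [/\ i != j, x \in V i & y \in V j]].

Definition total_weighting (G : sgraph) (k : nat) (w : G + edge G -> nat)
    : Prop :=
  forall z, 1 <= w z <= k.

Definition full_sum (G : sgraph) (w : G + edge G -> nat) (v : G) : nat :=
  w (inl v) + \sum_(e : edge G | v \in val e) w (inr e)
            + \sum_(u : G | adj v u) w (inl u).

Definition full_sum_distinguishing (G : sgraph) (w : G + edge G -> nat)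
    : Prop :=
  forall u v : G, adj u v -> full_sum w u <> full_sum w v.

Definition ven_colorable (G : sgraph) (k : nat) : Prop :=
  exists2 w : G + edge G -> nat,
    total_weighting k w & full_sum_distinguishing w.

(* [chi_ven_eq G k] says that the minimum exists and equals k.  It is a
   relation because some graphs, such as K_2, admit no distinguishing
   weighting for any k. *)
Definition chi_ven_eq (G : sgraph) (k : nat) : Prop :=
  ven_colorable G k /\ forall j, ven_colorable G j -> k <= j.

(* Main.v *)
Require Import Defs.
From mathcomp Require Import all_boot.
From mathcomp Require Import zify.

(** Give each vertex a weight depending only on its part, and each edge a weight
depending only on the pair of parts it joins; the full sum is then constant on
each part.  With weights all 1 a vertex of [V i] gets [1 + 2 (|G| - |V i|)],
which settles the case of distinct sizes and shows that 1 is not enough when two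
sizes agree.  For sizes [a, a, c], not all 1, weights in {1, 2} suffice:
 - if [a = c], put 2 on the first two parts and on the edges between the second
   and third parts;
 - if [a <> c] and [3 a <> 2 c], put 2 only on the edges between the second and
   third parts;
 - if [3 a = 2 c], put 2 only on the vertices of the second part. *)

Set Implicit Arguments.
Unset Strict Implicit.
Unset Printing Implicit Defensive.

(** The map [u |-> [set v; u]] is a bijection from the neighbors of [v] onto the edges at [v]. *)
Lemma sum_incident_edges (G : sgraph) (v : G) (F : {set G} -> nat) :
  \sum_(e : edge G | v \in val e) F (val e)
  = \sum_(u : G | adj v u) F [set v; u].
Proof.
have -> : \sum_(e : edge G | v \in val e) F (val e)
          = \sum_(e in edges G | v \in e) F e.
  by rewrite [RHS](big_sub_cond (edges G)).
have inj : {in [pred u | adj v u] &, injective (fun u => [set v; u])}.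
  move=> u1 u2; rewrite !inE => a1 a2 eq12.
  have : u1 \in [set v; u2] by rewrite -eq12 !inE eqxx orbT.
  rewrite !inE => /orP[] /eqP // eq1.
  by rewrite eq1 adj_irrefl in a1.
rewrite -(big_imset F inj); apply: eq_bigl => e.
apply/andP/imsetP => [[/imsetP[[x y] /= axy ->]]|[u avu ->]].
  move: axy; rewrite !inE /= => axy /orP[] /eqP ->; first by exists y.
  by exists x; rewrite ?inE 1?adj_sym // setUC.
rewrite !inE eqxx; split=> //.
by apply: (imset_f (fun q : G * G => [set q.1; q.2]) (x := (v, u))); rewrite inE.
Qed.

(** A neighbor [u] in part [i] contributes its own weight [x i] and that of the edge [[set v; u]],
    whose image under [p] is [[set p v; i]]. *)
Lemma full_sum_parts (G : sgraph) (r : nat) (p : G -> 'I_r)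
    (x : 'I_r -> nat) (E : {set 'I_r} -> nat) (w : G + edge G -> nat) (v : G) :
  (forall u v : G, adj u v = (p u != p v)) ->
  (forall u, w (inl u) = x (p u)) ->
  (forall e, w (inr e) = E (p @: val e)) ->
  full_sum w v
  = x (p v) + \sum_(i | i != p v)
                #|[pred u | p u == i]| * (E [set p v; i] + x i).
Proof.
move=> adjp wx wE; rewrite /full_sum wx -addnA; congr (_ + _).
rewrite (eq_bigr (fun e : edge G => E (p @: val e)) (fun e _ => wE e)).
rewrite (sum_incident_edges v (fun e => E (p @: e))) -big_split /=.
rewrite (partition_big p (fun i => i != p v)) => [|u] /=; last first.
  by rewrite adjp eq_sym.
apply: eq_bigr => i ne_i; rewrite -sum_nat_const.
apply: eq_big => [u|u /andP[_ /eqP <-]]; last by rewrite wx imsetU1 imset_set1.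
rewrite inE adjp; case: (eqVneq (p u) i) => [->|_]; last by rewrite andbF.
by rewrite eq_sym ne_i.
Qed.

(** The parts cover and are disjoint, so each vertex has exactly one part index. *)
Lemma complete_multipartite_part (G : sgraph) (r : nat) (V : 'I_r -> {set G}) :
  complete_multipartite V ->
  exists2 p : G -> 'I_r, forall i, V i = [set v | p v == i]
                       & forall u v, adj u v = (p u != p v).
Proof.
case=> _ disjV covV adjV.
have exV v : exists i, v \in V i.
  have : v \in \bigcup_i V i by rewrite covV inE.
  by case/bigcupP => i _; exists i.
pose p v := xchoose (exV v).
have pV v : v \in V (p v) := xchooseP (exV v).
have uniqp v i : v \in V i -> p v = i.
  move=> vi; apply/eqP/negPn/negP => /disjV /pred0P /(_ v) /=.
  by rewrite pV vi.
exists p => [i|u v].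
  by apply/setP => v; rewrite inE; apply/idP/eqP => [/uniqp|<-].
apply/idP/idP => [/adjV [i [j [ne /uniqp -> /uniqp ->]]] //|ne].
by apply/adjV; exists (p u), (p v).
Qed.

Lemma ord3_cases (i j k l : 'I_3) :
  j != i -> k != i -> j != k -> [\/ l = i, l = j | l = k].
Proof.
move=> ji ki jk; case: (eqVneq l i) => [->|li]; first by constructor 1.
case: (eqVneq l j) => [->|lj]; first by constructor 2.
constructor 3; apply: val_inj; move: ji ki jk li lj; rewrite -!val_eqE /=.
by move: (ltn_ord i) (ltn_ord j) (ltn_ord k) (ltn_ord l); lia.
Qed.

Lemma sum_ord3_neq (i j k : 'I_3) (F : 'I_3 -> nat) :
  j != i -> k != i -> j != k -> \sum_(l | l != i) F l = F j + F k.
Proof.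
move=> ji ki jk; rewrite (bigD1 j ji) (bigD1 k) /=; last by rewrite ki eq_sym.
rewrite big_pred0 ?addn0 // => l; case: (ord3_cases l ji ki jk) => ->;
  by rewrite eqxx ?andbF.
Qed.

Lemma tripartite_colorable2 (G : sgraph) (p : G -> 'I_3) (i j k : 'I_3) :
  (forall u v : G, adj u v = (p u != p v)) ->
  j != i -> k != i -> j != k ->
  #|[pred v | p v == i]| = #|[pred v | p v == j]| ->
  0 < #|[pred v | p v == i]| -> 0 < #|[pred v | p v == k]| ->
  1 < maxn #|[pred v | p v == i]| #|[pred v | p v == k]| ->
  ven_colorable G 2.
Proof.
set a := #|[pred v | p v == i]|; set c := #|[pred v | p v == k]|.
move=> adjp ji ki jk aj a_gt0 c_gt0 max_gt1.
have ij : i != j by rewrite eq_sym.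
have ik : i != k by rewrite eq_sym.
have kj : k != j by rewrite eq_sym.
(* [bi], [bj], [bjk] tell whether [V i], [V j] and the edges between [V j]
   and [V k] get weight 2. *)
suff [[[bi bj] bjk] /and3P[d1 d2 d3]] : exists b : bool * bool * bool,
    let: (bi, bj, bjk) := b in
    let Fi := bi.+1 + (a * (1 + bj.+1) + c * (1 + 1)) in
    let Fj := bj.+1 + (a * (1 + bi.+1) + c * (bjk.+1 + 1)) in
    let Fk := 1 + (a * (1 + bi.+1) + a * (bjk.+1 + bj.+1)) in
    [&& Fi != Fj, Fi != Fk & Fj != Fk].
- pose x l := (bi && (l == i) || bj && (l == j)).+1.
  pose E S := (bjk && (S == [set j; k])).+1.
  pose w z := match z with
    | inl v => x (p v)
    | inr e => E (p @: val (e : edge G))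
    end.
  exists w; first by case=> [v|e]; rewrite /= /x /E; case: (_ || _); case: (_ && _).
  have xi : x i = bi.+1 by rewrite /x eqxx (negbTE ij) andbT andbF orbF.
  have xj : x j = bj.+1 by rewrite /x eqxx (negbTE ji) andbT andbF.
  have xk : x k = 1 by rewrite /x (negbTE ki) (negbTE kj) !andbF.
  have Ei l : E [set i; l] = 1.
    rewrite /E; case: eqP; rewrite ?andbF // => /setP /(_ i).
    by rewrite !inE eqxx (negbTE ij) (negbTE ik).
  have Ejk : E [set j; k] = bjk.+1 by rewrite /E eqxx andbT.
  have wsum v := full_sum_parts (w := w) v adjp
    (fun=> erefl) (fun=> erefl).
  have sumi v : p v = i ->
      full_sum w v = bi.+1 + (a * (1 + bj.+1) + c * (1 + 1)).
    move=> pv; rewrite wsum pv (sum_ord3_neq _ ji ki jk) !Ei xi xj xk.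
    by rewrite -aj.
  have sumj v : p v = j ->
      full_sum w v = bj.+1 + (a * (1 + bi.+1) + c * (bjk.+1 + 1)).
    move=> pv; rewrite wsum pv (sum_ord3_neq _ ij kj ik) xi xj xk Ejk.
    by rewrite [[set j; i]]setUC Ei.
  have sumk v : p v = k ->
      full_sum w v = 1 + (a * (1 + bi.+1) + a * (bjk.+1 + bj.+1)).
    move=> pv; rewrite wsum pv (sum_ord3_neq _ ik jk ij) xi xj xk.
    by rewrite [[set k; i]]setUC [[set k; j]]setUC Ei Ejk -aj.
  move=> u v; rewrite adjp => /eqP ne.
  case: (ord3_cases (p u) ji ki jk) => pu; case: (ord3_cases (p v) ji ki jk) => pv;
    rewrite ?(sumi _ pu) ?(sumj _ pu) ?(sumk _ pu)
            ?(sumi _ pv) ?(sumj _ pv) ?(sumk _ pv);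
    by [case: ne; rewrite pu pv | apply/eqP | apply/eqP; rewrite eq_sym].
case: (eqVneq a c) => [ac|ac].
  (* The sums are [5a + 2], [6a + 2], [7a + 1]; the last two differ because [a > 1]. *)
  by exists (true, true, true) => /=; lia.
case: (eqVneq (3 * a) (2 * c)) => [ac32|ac32].
  (* The sums are [6a + 1], [5a + 2], [5a + 1]; here [a] is even, hence not 1. *)
  by exists (false, true, false) => /=; lia.
(* The sums are [1 + 2a] plus [2c], [3c] and [3a] respectively. *)
by exists (false, false, true) => /=; lia.
Qed.

(** Incident edges and neighbors each contribute the degree of [v], and the neighbors are the
    vertices outside its part. *)
Lemma full_sum_const1 (G : sgraph) (r : nat) (p : G -> 'I_r)
    (w : G + edge G -> nat) (v : G) :
  (forall u v : G, adj u v = (p u != p v)) -> (forall z, w z = 1) ->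
  full_sum w v = 1 + 2 * (#|G| - #|[pred u | p u == p v]|).
Proof.
move=> adjp w1.
rewrite (full_sum_parts (x := fun=> 1) (E := fun=> 1) v adjp) //.
congr (_ + _); rewrite -big_distrl /= mulnC; congr (_ * _).
have -> : #|G| = \sum_i #|[pred u | p u == i]|.
  rewrite -sum1_card (partition_big p xpredT) //=.
  by apply: eq_bigr => i _; rewrite sum1_card.
by rewrite [in RHS](bigD1 (p v)) //= addKn.
Qed.

Theorem theorem2p2 (G : sgraph) (V : 'I_3 -> {set G})
    (HV : complete_multipartite V)
    (HK3 : ~ graph_iso G (complete_graph 3)) :
  ((forall i j : 'I_3, i < j -> #|V i| <> #|V j|) -> chi_ven_eq G 1) /\
  (~ (forall i j : 'I_3, i < j -> #|V i| <> #|V j|) -> chi_ven_eq G 2).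
Proof.
have [p Vp adjp] := complete_multipartite_part HV.
have cardV i : #|V i| = #|[pred v | p v == i]| by rewrite Vp cardsE.
have exV i : exists v, p v == i.
  case: HV => /(_ i) /set0Pn[v] + _ _ _.
  by rewrite Vp inE; exists v.
have card_gt0 i : 0 < #|[pred v | p v == i]|.
  by apply/card_gt0P; apply: exV.
have [v0 _] := exV ord0.
have colorable_gt0 m : ven_colorable G m -> 0 < m.
  by case=> w /(_ (inl v0)) /andP[w1 wm] _; apply: leq_trans w1 wm.
split=> [dist|ndist].
  split=> //; exists (fun=> 1) => // u v; rewrite adjp => ne.
  rewrite !(full_sum_const1 _ adjp) //.
  have cne : #|V (p u)| <> #|V (p v)|.
    have [/dist //|/dist + /esym //|/val_inj eq_p] := ltngtP (p u) (p v).
    by rewrite eq_p eqxx in ne.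
  (* These bounds keep the natural subtractions from truncating, so different part sizes give
     different sums. *)
  have := max_card (mem (V (p u))); have := max_card (mem (V (p v))).
  by move: cne; rewrite !cardV; lia.
have /existsP[i /existsP[j /andP[lt_ij /eqP eq_ij]]] :
    [exists i : 'I_3, exists j : 'I_3, (i < j) && (#|V i| == #|V j|)].
  apply: contraT => /existsPn no; case: ndist => i j lt_ij eq_ij.
  by have /existsPn /(_ j) := no i; rewrite lt_ij eq_ij eqxx.
have ji : j != i by rewrite -val_eqE gtn_eqF.
split.
  have [k ki jk] : exists2 k : 'I_3, k != i & j != k.
    (* The indices 0, 1, 2 add up to 3, so this is the third one; it is below 3 because [i < j]. *)
    have lt3 : 3 - (i + j) < 3 by lia.
    exists (Ordinal lt3); rewrite -val_eqE /=; move: (ltn_ord j); lia.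
  apply: (tripartite_colorable2 adjp ji ki jk); rewrite ?card_gt0 -?cardV //.
  (* If no part had two vertices, [p] would be an isomorphism onto the triangle. *)
  rewrite ltnNge; apply/negP; rewrite geq_max => /andP[ai ck]; apply: HK3.
  have inj : injective p.
    move=> u v puv; have /card_le1_eqP : #|V (p u)| <= 1.
      by case: (ord3_cases (p u) ji ki jk) => ->; rewrite -?eq_ij.
    by apply; rewrite Vp inE ?puv.
  exists p => [|u v]; last by rewrite adjp.
  exists (fun l => xchoose (exV l)) => [u|l]; last exact/eqP/(xchooseP (exV l)).
  exact/inj/eqP/(xchooseP (exV (p u))).
move=> m colm; rewrite ltn_neqAle colorable_gt0 // andbT.
(* With [m = 1] all weights are 1, and adjacent vertices from the two equal parts get the same
   sum. *)
apply/eqP => m1; case: colm => w; rewrite -m1 => tw.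
have w1 z : w z = 1 by apply/eqP; rewrite eqn_leq andbC tw.
have [[u /eqP pu] [v /eqP pv]] := (exV i, exV j).
move=> /(_ u v); rewrite !(full_sum_const1 _ adjp w1) adjp pu pv eq_sym.
by move=> /(_ ji); rewrite -!cardV eq_ij.
Qed.
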